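(* Fix $n\ge 2$ and let $W\subseteq\{1,\dots,n\}^{\mathbb{Z}}$ be an infinite totally transitive subshift. Then there is a sequence of subshifts $X_m\subseteq\{1,\dots,n\}^{\mathbb{Z}}$ such that each $(X_m,\sigma)$ is a CAM $\mathbb{Z}$-system and $X_m\to W$ in the Hausdorff metric on closed subsets of $\{1,\dots,n\}^{\mathbb{Z}}$.
   Context: $\{1,\dots,n\}^{\mathbb{Z}}$ carries the metric $d(x,y)=2^{-\inf\{|k|:x_k\neq y_k\}}$ and the shift $(\sigma x)_k=x_{k+1}$; a subshift is a closed $\sigma$-invariant subset. A subshift $W$ is totally transitive if $(W,\sigma^k)$ is topologically transitive for every $k\ge1$. A $\mathbb{Z}$-system $(X,T)$ is a compact metric space with a homeomorphism $T$; it is topologically transitive if for all nonempty open $U,V$ there is $j$ with $T^jU\cap V\neq\emptyset$; the action is faithful if $T^j=\mathrm{id}$ only for $j=0$; a point is periodic if its orbit is finite. The system is chaotic almost minimal (CAM) if: (1) it is topologically transitive and the action is faithful; (2) the periodic points are dense; (3) every proper closed $T$-invariant subset is finite. *)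

(* Defs.v *)
From Stdlib Require Import Reals ZArith List ClassicalEpsilon.
Open Scope R_scope.

Definition config := Z -> nat.
Definition cset := config -> Prop.

Definition full_shift (n : nat) : cset :=
  fun x => forall k : Z, (1 <= x k <= n)%nat.

Definition diff_at (x y : config) (m : nat) : Prop :=
  exists k : Z, Z.abs_nat k = m /\ x k <> y k.

(* inf {|k| : x_k <> y_k} (chosen classically; meaningful when x <> y) *)
Definition first_diff (x y : config) : nat :=
  epsilon (inhabits 0%nat)
    (fun m => diff_at x y m /\ forall m', diff_at x y m' -> (m <= m')%nat).

Definition dist (x y : config) : R :=
  if excluded_middle_informative (x = y) then 0 else (/ 2) ^ (first_diff x y).

Definition shift_pow (j : Z) (x : config) : config := fun k => x (k + j)%Z.
Definition shift (x : config) : config := shift_pow 1 x.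

Definition is_finite_set (A : cset) : Prop :=
  exists l : list config, forall x, A x -> In x l.

Definition closed_in (n : nat) (X : cset) : Prop :=
  forall x, full_shift n x ->
    (forall eps, 0 < eps -> exists y, X y /\ dist x y < eps) -> X x.

Definition shift_invariant (X : cset) : Prop :=
  forall x, X x <-> X (shift x).

Definition subshift (n : nat) (X : cset) : Prop :=
  (forall x, X x -> full_shift n x) /\ closed_in n X /\ shift_invariant X.

Definition open_in (X U : cset) : Prop :=
  (forall x, U x -> X x) /\
  forall x, U x -> exists eps, 0 < eps /\ forall y, X y -> dist x y < eps -> U y.

Definition transitive_pow (k : Z) (X : cset) : Prop :=
  forall U V, open_in X U -> open_in X V -> (exists u, U u) -> (exists v, V v) ->
    exists j : Z, exists x, U x /\ V (shift_pow (k * j) x).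

Definition topologically_transitive (X : cset) : Prop := transitive_pow 1 X.

Definition totally_transitive (X : cset) : Prop :=
  forall k : Z, (1 <= k)%Z -> transitive_pow k X.

Definition faithful (X : cset) : Prop :=
  forall j : Z, (forall x, X x -> shift_pow j x = x) -> j = 0%Z.

Definition periodic (x : config) : Prop :=
  is_finite_set (fun y => exists j : Z, y = shift_pow j x).

Definition periodic_dense (X : cset) : Prop :=
  forall x, X x -> forall eps, 0 < eps -> exists p, X p /\ periodic p /\ dist x p < eps.

(* chaotic almost minimal (for a subshift X with the shift map) *)
Definition CAM (n : nat) (X : cset) : Prop :=
  (topologically_transitive X /\ faithful X) /\
  periodic_dense X /\
  (forall Y : cset, (forall y, Y y -> X y) -> (exists x, X x /\ ~ Y x) ->
     closed_in n Y -> shift_invariant Y -> is_finite_set Y).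

Definition hausdorff_converges (Xs : nat -> cset) (W : cset) : Prop :=
  forall eps, 0 < eps -> exists M : nat, forall m, (M <= m)%nat ->
    (forall x, Xs m x -> exists y, W y /\ dist x y < eps) /\
    (forall y, W y -> exists x, Xs m x /\ dist x y < eps).

(* Main.v *)
(* Choose a word v of W containing all words of W of length L and two return words
   a, b of v: av and bv are words of W starting with v, so every factor of length L
   of a concatenation of a's and b's is a word of W. Put w_0 = b, h_0 = {a} and build
     w_{j+1} = w_j . prod_{g in {w_j} + h_j} (g^j . w_j),   h_{j+1} = {w_j} + h_j.
   The points all of whose windows occur in some w_j form a subshift X, which contains
   the periodic points g^oo for g in every h_j, because the exponents grow. For fixed j
   every later w_J is a concatenation of copies of w_j separated by powers of elements
   of h_j, so a point of X avoiding w_j is, on every window, a piece of some g^oo with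
   g in h_j: there are finitely many such points, and every proper subsystem avoids
   some w_j. Infiniteness of W lets us choose b not |a|-periodic, which makes the action
   faithful; total transitivity provides return words. *)
From Stdlib Require Import Reals ZArith List Lia Lra ClassicalEpsilon FunctionalExtensionality.
Require Import Defs.
Import ListNotations.

(** * Finite words, their powers, and windows of configurations *)

Definition factor (u w : list nat) : Prop := exists l r, w = l ++ u ++ r.

Definition power (q : nat) (w : list nat) : list nat := concat (repeat w q).

Fixpoint window (x : config) (t : Z) (k : nat) : list nat :=
  match k with
  | O => []
  | S k' => x t :: window x (t + 1) k'
  end.

(** The bi-infinite word [w^oo], with a copy of [w] at every multiple of its length; the default 0
    is reached only for empty [w]. *)
Definition per (w : list nat) : config :=
  fun k => nth (Z.to_nat (k mod Z.of_nat (length w))) w 0%nat.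

(** The combinatorial form of [dist x y < (/ 2) ^ N]. *)
Definition agree (N : nat) (x y : config) : Prop :=
  forall k, (- Z.of_nat N <= k <= Z.of_nat N)%Z -> x k = y k.

Lemma factor_refl u : factor u u.
Proof. exists [], []. now rewrite app_nil_r. Qed.

Lemma factor_trans u v w : factor u v -> factor v w -> factor u w.
Proof.
  intros (l & r & ->) (l' & r' & ->). exists (l' ++ l), (r ++ r').
  now rewrite <- !app_assoc.
Qed.

Lemma factor_length u w : factor u w -> (length u <= length w)%nat.
Proof. intros (l & r & ->). rewrite !length_app. lia. Qed.

Lemma factor_app_l u v w : factor u v -> factor u (v ++ w).
Proof. intros H. apply factor_trans with v; trivial. now exists [], w. Qed.

Lemma factor_app_r u v w : factor u w -> factor u (v ++ w).
Proof.
  intros H. apply factor_trans with w; trivial.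
  exists v, []. now rewrite app_nil_r.
Qed.

Lemma app_eq_split {A} (l1 r1 l2 r2 : list A) :
  l1 ++ r1 = l2 ++ r2 -> length l1 = length l2 -> l1 = l2 /\ r1 = r2.
Proof.
  revert l2. induction l1 as [|c l1 IH]; intros [|c2 l2] E Hl; simpl in *;
    try discriminate; auto.
  injection E as -> E. destruct (IH l2 E) as [-> ->]; auto.
Qed.

Lemma app_eq_prefix {A} (l1 r1 l2 r2 : list A) :
  l1 ++ r1 = l2 ++ r2 -> (length l1 <= length l2)%nat ->
  exists e, l2 = l1 ++ e /\ r1 = e ++ r2.
Proof.
  intros E Hl. destruct (app_eq_app _ _ _ _ E) as [e [[-> ->]|[-> ->]]].
  - rewrite length_app in Hl. destruct e as [|c e]; simpl in Hl; [|lia].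
    exists []. now rewrite !app_nil_r.
  - now exists e.
Qed.

Lemma power_add p q w : power (p + q) w = power p w ++ power q w.
Proof. unfold power. now rewrite repeat_app, concat_app. Qed.

Lemma power_S q w : power (S q) w = w ++ power q w.
Proof. reflexivity. Qed.

Lemma power_S_r q w : power (S q) w = power q w ++ w.
Proof.
  replace (S q) with (q + 1)%nat by lia. rewrite power_add.
  unfold power at 2; simpl. now rewrite app_nil_r.
Qed.

Lemma power_length q w : length (power q w) = (q * length w)%nat.
Proof.
  induction q as [|q IH]; [reflexivity|].
  rewrite power_S, length_app, IH. lia.
Qed.

Lemma power_factor p q w : (p <= q)%nat -> factor (power p w) (power q w).
Proof.
  intros H. replace q with (p + (q - p))%nat by lia. rewrite power_add.
  apply factor_app_l, factor_refl.
Qed.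

Lemma window_length x t k : length (window x t k) = k.
Proof. revert t; induction k; intros; simpl; auto. Qed.

Lemma window_app x t p q :
  window x t (p + q) = window x t p ++ window x (t + Z.of_nat p) q.
Proof.
  revert t. induction p as [|p IH]; intros t; simpl.
  - f_equal. lia.
  - rewrite IH. do 3 f_equal. lia.
Qed.

Lemma window_ext x y t s k :
  window x t k = window y s k <->
  forall i, (0 <= i < Z.of_nat k)%Z -> x (t + i)%Z = y (s + i)%Z.
Proof.
  revert t s. induction k as [|k IH]; intros t s; simpl window.
  - split; auto. intros _ i; lia.
  - split.
    + intros E. injection E as E0 E1.
      intros i Hi. destruct (Z.eq_dec i 0) as [->|Hn].
      * now rewrite !Z.add_0_r.
      * rewrite IH in E1. specialize (E1 (i - 1)%Z ltac:(lia)).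
        now replace (t + 1 + (i - 1))%Z with (t + i)%Z in E1 by lia;
          replace (s + 1 + (i - 1))%Z with (s + i)%Z in E1 by lia.
    + intros H. f_equal.
      * specialize (H 0%Z ltac:(lia)). now rewrite !Z.add_0_r in H.
      * apply IH. intros i Hi. specialize (H (1 + i)%Z ltac:(lia)).
        now rewrite !Z.add_assoc in H.
Qed.

Lemma window_shift j x t k : window (shift_pow j x) t k = window x (t + j) k.
Proof. apply window_ext. intros i _. unfold shift_pow. f_equal. lia. Qed.

Lemma window_eq_nth x t w :
  window x t (length w) = w <->
  forall i, (i < length w)%nat -> x (t + Z.of_nat i)%Z = nth i w 0%nat.
Proof.
  revert t. induction w as [|c w IH]; intros t; simpl.
  - split; trivial. intros _ i; lia.
  - split.
    + intros E. injection E as E0 E1. rewrite IH in E1.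
      intros [|i] Hi; [now rewrite Z.add_0_r|].
      rewrite <- E1 by lia. f_equal. lia.
    + intros H. f_equal.
      * specialize (H 0%nat ltac:(lia)). now rewrite Z.add_0_r in H.
      * apply IH. intros i Hi. rewrite <- (H (S i)) by lia. f_equal. lia.
Qed.

Lemma window_factor x t k s k' :
  (t <= s)%Z -> (s + Z.of_nat k' <= t + Z.of_nat k)%Z ->
  factor (window x s k') (window x t k).
Proof.
  intros H1 H2.
  replace k with (Z.to_nat (s - t) + (k' + (k - k' - Z.to_nat (s - t))))%nat by lia.
  rewrite !window_app.
  replace (t + Z.of_nat (Z.to_nat (s - t)))%Z with s by lia. now do 2 eexists.
Qed.

Lemma window_eq_app x t l r :
  window x t (length (l ++ r)) = l ++ r ->
  window x t (length l) = l /\ window x (t + Z.of_nat (length l)) (length r) = r.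
Proof.
  rewrite length_app, window_app. intros E.
  apply app_eq_split in E; trivial. now rewrite window_length.
Qed.

Lemma factor_occurs u w x t :
  factor u w -> window x t (length w) = w ->
  exists s, (t <= s)%Z /\ (s + Z.of_nat (length u) <= t + Z.of_nat (length w))%Z /\
    window x s (length u) = u.
Proof.
  intros (l & r & ->) E. apply window_eq_app in E as [_ E].
  apply window_eq_app in E as [E _].
  eexists. split; [|split; [|exact E]]; rewrite ?length_app; lia.
Qed.

Lemma factor_window u x t k :
  factor u (window x t k) -> exists s, window x s (length u) = u.
Proof.
  intros H. destruct (factor_occurs _ _ x t H) as (s & _ & _ & E); eauto.
  now rewrite window_length.
Qed.

(** * Shifts and periodic configurations *)

Lemma shift_pow_add i j x : shift_pow i (shift_pow j x) = shift_pow (i + j) x.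
Proof. extensionality k. unfold shift_pow. f_equal. lia. Qed.

Lemma shift_pow_0 x : shift_pow 0 x = x.
Proof. extensionality k. unfold shift_pow. f_equal. lia. Qed.

Lemma shift_pow_invariant X : shift_invariant X ->
  forall j x, X x -> X (shift_pow j x).
Proof.
  intros HX.
  assert (Hn : forall (m : nat) x, X x <-> X (shift_pow (Z.of_nat m) x)).
  { induction m as [|m IH]; intros x.
    - now rewrite shift_pow_0.
    - replace (shift_pow (Z.of_nat (S m)) x) with (shift (shift_pow (Z.of_nat m) x)).
      + rewrite <- (HX (shift_pow (Z.of_nat m) x)). apply IH.
      + unfold shift. rewrite shift_pow_add. f_equal. lia. }
  intros j x Hx. destruct (Z.le_gt_cases 0 j).
  - replace j with (Z.of_nat (Z.to_nat j)) by lia. now apply Hn.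
  (* For negative [j] the equivalence is read backwards: shifting [shift_pow j x] by [- j] returns
     [x]. *)
  - apply (Hn (Z.to_nat (- j))). rewrite shift_pow_add.
    replace (Z.of_nat (Z.to_nat (- j)) + j)%Z with 0%Z by lia.
    now rewrite shift_pow_0.
Qed.

Lemma period_mul (x : config) d : (forall k, x (k + d)%Z = x k) ->
  forall q k, x (k + q * d)%Z = x k.
Proof.
  intros H.
  assert (Hn : forall (m : nat) k, x (k + Z.of_nat m * d)%Z = x k).
  { induction m as [|m IH]; intros k.
    - f_equal; lia.
    - rewrite <- (IH k), <- (H (k + Z.of_nat m * d)%Z). f_equal. lia. }
  intros q k. destruct (Z.le_gt_cases 0 q).
  - rewrite <- (Hn (Z.to_nat q) k). f_equal. rewrite Z2Nat.id; lia.
  - rewrite <- (Hn (Z.to_nat (- q)) (k + q * d)%Z). f_equal. rewrite Z2Nat.id; lia.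
Qed.

Lemma period_mod (x : config) d : (forall k, x (k + d)%Z = x k) ->
  forall k, d <> 0%Z -> x (k mod d)%Z = x k.
Proof.
  intros H k Hd. rewrite <- (period_mul x d H (k / d) (k mod d)). f_equal.
  rewrite (Z.div_mod k d) at 3 by trivial. lia.
Qed.

Lemma length_pos {A} (w : list A) : w <> [] -> (0 < length w)%nat.
Proof. destruct w; simpl; [congruence|lia]. Qed.

Lemma per_period w k : w <> [] -> per w (k + Z.of_nat (length w))%Z = per w k.
Proof.
  intros Hw. apply length_pos in Hw. unfold per. do 2 f_equal.
  replace (k + Z.of_nat (length w))%Z with (k + 1 * Z.of_nat (length w))%Z by lia.
  apply Z_mod_plus_full.
Qed.

Lemma window_per w z q : w <> [] ->
  window (per w) (z * Z.of_nat (length w)) (length (power q w)) = power q w.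
Proof.
  intros Hw. revert z. induction q as [|q IH]; intros z; [reflexivity|].
  rewrite power_S, length_app, window_app. f_equal.
  - apply window_eq_nth. intros i Hi. unfold per.
    rewrite Z.add_comm, Z_mod_plus_full, Z.mod_small by lia. now rewrite Nat2Z.id.
  - rewrite <- IH with (z := (z + 1)%Z) at 2. f_equal. lia.
Qed.

Lemma window_per_factor w t k : w <> [] ->
  exists q, factor (window (per w) t k) (power q w).
Proof.
  intros Hw. pose proof (length_pos w Hw).
  (* A period has length at least 1, so [N] periods on each side of 0 cover the window. *)
  set (N := (Z.to_nat (Z.abs t) + k)%nat).
  exists (N + N)%nat. rewrite <- (window_per w (- Z.of_nat N)) by trivial.
  rewrite power_length. apply window_factor; unfold N; nia.
Qed.

Lemma eq_per_window (x : config) d : (0 < d)%nat ->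
  (forall k, x (k + Z.of_nat d)%Z = x k) -> x = per (window x 0 d).
Proof.
  intros Hd H. extensionality k.
  assert (Hw : window x 0 d <> []) by (destruct d; [lia|discriminate]).
  assert (E : window (per (window x 0 d)) 0 d = window x 0 d).
  { pose proof (window_per (window x 0 d) 0 1 Hw) as E.
    unfold power in E; simpl concat in E. rewrite app_nil_r in E.
    now rewrite window_length in E. }
  rewrite window_ext in E.
  rewrite <- (period_mod x _ H) by lia.
  rewrite <- (period_mod (per (window x 0 d)) (Z.of_nat d)).
  - symmetry. apply (E (k mod Z.of_nat d)%Z). apply Z.mod_pos_bound. lia.
  - intros i. pose proof (per_period _ i Hw) as P. now rewrite window_length in P.
  - lia.
Qed.

(** * The metric and agreement on central windows *)

Lemma first_diff_spec x y : x <> y ->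
  diff_at x y (first_diff x y) /\
  forall m, diff_at x y m -> (first_diff x y <= m)%nat.
Proof.
  intros Hxy. unfold first_diff. apply epsilon_spec.
  assert (Hex : exists m, diff_at x y m).
  { apply NNPP. intros Hn. apply Hxy. extensionality k. apply NNPP. intros Hk.
    apply Hn. exists (Z.abs_nat k). now exists k. }
  destruct Hex as [m Hm]. induction m as [m IH] using lt_wf_ind.
  destruct (classic (exists m', (m' < m)%nat /\ diff_at x y m'))
    as [(m' & Hlt & Hd)|Hn].
  - eauto.
  - exists m. split; trivial. intros m' Hd. apply Nat.nlt_ge. intros Hlt.
    apply Hn. eauto.
Qed.

Lemma half_pow_lt p q : (p < q)%nat -> (/ 2) ^ q < (/ 2) ^ p.
Proof.
  intros H. induction H as [|q H IH]; simpl.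
  - pose proof (pow_lt (/ 2) p). lra.
  - pose proof (pow_lt (/ 2) q). lra.
Qed.

Lemma dist_lt_agree N x y : dist x y < (/ 2) ^ N -> agree N x y.
Proof.
  unfold dist. destruct (excluded_middle_informative (x = y)) as [->|Hxy].
  - now intros _ k _.
  - intros H k Hk. apply NNPP. intros Hn.
    destruct (first_diff_spec x y Hxy) as [_ Hmin].
    assert (Hle : (first_diff x y <= N)%nat).
    { etransitivity; [apply Hmin; now exists k|]. lia. }
    destruct (Nat.eq_dec (first_diff x y) N) as [E|E].
    + rewrite E in H. lra.
    + pose proof (half_pow_lt (first_diff x y) N ltac:(lia)). lra.
Qed.

Lemma agree_dist_lt N x y : agree N x y -> dist x y < (/ 2) ^ N.
Proof.
  intros H. unfold dist. destruct (excluded_middle_informative (x = y)) as [E|Hxy].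
  - apply pow_lt. lra.
  - apply half_pow_lt. destruct (first_diff_spec x y Hxy) as [(k & Ek & Hk) _].
    apply Nat.nle_gt. intros Hle. apply Hk, H. lia.
Qed.

Lemma half_pow_small eps : 0 < eps -> exists N, (/ 2) ^ N < eps.
Proof.
  intros H. destruct (pow_lt_1_zero (/ 2) ltac:(rewrite Rabs_pos_eq; lra) eps H)
    as [N HN].
  exists N. specialize (HN N (le_n N)). rewrite Rabs_pos_eq in HN; trivial.
  apply pow_le. lra.
Qed.

Lemma agree_window N x y t k : agree N x y ->
  (- Z.of_nat N <= t)%Z -> (t + Z.of_nat k <= Z.of_nat N + 1)%Z ->
  window x t k = window y t k.
Proof. intros H H1 H2. apply window_ext. intros i Hi. apply H. lia. Qed.

Lemma window_agree N x y :
  window x (- Z.of_nat N) (2 * N + 1) = window y (- Z.of_nat N) (2 * N + 1) ->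
  agree N x y.
Proof.
  intros E k Hk. rewrite window_ext in E.
  specialize (E (k + Z.of_nat N)%Z ltac:(lia)).
  now replace (- Z.of_nat N + (k + Z.of_nat N))%Z with k in E by lia.
Qed.

(** A finite set is closed: if [x] differed from every element of [l], the sum of the absolute
    values of places of disagreement would be one [N] that excludes them all. *)
Lemma finite_agree_In (l : list config) x :
  (forall N, exists y, In y l /\ agree N x y) -> In x l.
Proof.
  intros H. apply NNPP. intros Hx.
  assert (Hb : exists N, forall y, In y l -> ~ agree N x y).
  { clear H. induction l as [|c l IH]; [now exists 0%nat|].
    destruct IH as [N HN]; [intros Hl; apply Hx; now right|].
    assert (Hc : exists k, x k <> c k).
    { apply NNPP. intros Hn. apply Hx. left. extensionality k. apply NNPP.
      intros Hk. apply Hn. exists k. congruence. }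
    destruct Hc as [k Hk]. exists (N + Z.abs_nat k)%nat.
    intros y [<-|Hy] Hag.
    - apply Hk, Hag. lia.
    - apply (HN y Hy). intros i Hi. apply Hag. lia. }
  destruct Hb as [N HN]. destruct (H N) as (y & Hy & Hag). now apply (HN y).
Qed.

Lemma per_shift_mod w s : w <> [] ->
  shift_pow s (per w) = shift_pow (s mod Z.of_nat (length w)) (per w).
Proof.
  intros Hw. pose proof (length_pos w Hw). extensionality k. unfold shift_pow.
  pose proof (fun i => per_period w i Hw) as P.
  rewrite <- (period_mul _ _ P (s / Z.of_nat (length w))
    (k + s mod Z.of_nat (length w))%Z).
  f_equal. rewrite (Z.div_mod s (Z.of_nat (length w))) at 1 by lia. lia.
Qed.

Definition per_orbit (w : list nat) : list config :=
  map (fun s => shift_pow (Z.of_nat s) (per w)) (seq 0 (length w)).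

Lemma per_orbit_In w s : w <> [] -> In (shift_pow s (per w)) (per_orbit w).
Proof.
  intros Hw. rewrite per_shift_mod by trivial. pose proof (length_pos w Hw).
  pose proof (Z.mod_pos_bound s (Z.of_nat (length w)) ltac:(lia)).
  apply in_map_iff. exists (Z.to_nat (s mod Z.of_nat (length w))). split.
  - f_equal. lia.
  - apply in_seq. lia.
Qed.

Lemma per_periodic w s : w <> [] -> periodic (shift_pow s (per w)).
Proof.
  intros Hw. exists (per_orbit w). intros y [j ->].
  rewrite shift_pow_add. now apply per_orbit_In.
Qed.

(** * Words made of copies of [w] separated by powers *)

(** Each gap is a power of a single element of [h]; the exponent may be 0, which lets copies of [w]
    be adjacent once [h] is nonempty. *)
Inductive separated (w : list nat) (h : list (list nat)) : list nat -> Prop :=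
| separated_one : separated w h w
| separated_cons g l G : In g h -> separated w h G ->
    separated w h (w ++ power l g ++ G).

Lemma separated_glue w h A B g l : separated w h A -> separated w h B ->
  In g h -> separated w h (A ++ power l g ++ B).
Proof.
  intros HA HB Hg. induction HA as [|g' l' G Hg' _ IH].
  - now constructor.
  - rewrite <- !app_assoc. now constructor.
Qed.

Lemma separated_app w h A B : h <> [] -> separated w h A -> separated w h B ->
  separated w h (A ++ B).
Proof.
  intros Hh HA HB. destruct h as [|g h]; [congruence|].
  exact (separated_glue w _ A B g 0 HA HB (or_introl eq_refl)).
Qed.

Lemma separated_power_app w h g l B : h <> [] -> separated w h g ->
  separated w h B -> separated w h (power l g ++ B).
Proof.
  intros Hh Hg HB. induction l as [|l IH]; simpl; trivial.
  rewrite power_S, <- app_assoc. now apply separated_app.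
Qed.

Lemma separated_head w h G : separated w h G -> exists G', G = w ++ G'.
Proof.
  intros [|g l G' _ _]; [exists []; now rewrite app_nil_r|eauto].
Qed.

(* A block without [w] inside a separated word meets at most one gap, together
   with parts of the two copies of [w] that bound it. *)
Lemma separated_avoid w h G p mid s :
  w <> [] -> separated w h G -> factor (p ++ mid ++ s) G ->
  ~ factor w (p ++ mid ++ s) ->
  (length w <= length p)%nat -> (length w <= length s)%nat ->
  exists g l, In g h /\ factor mid (power l g).
Proof.
  intros Hw HG Hf Hn Hp Hs. apply length_pos in Hw.
  induction HG as [|g l G Hg HG IH].
  - apply factor_length in Hf. rewrite !length_app in Hf. lia.
  - destruct (separated_head _ _ _ HG) as [G' ->].
    remember (p ++ mid ++ s) as u eqn:Eu.
    destruct Hf as (a & r & E). rewrite app_assoc in E.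
    destruct (app_eq_app _ _ _ _ E) as (e & [[E1 E2]|[E1 E2]]).
    (* The block starts before the second copy of [w]: it either covers that copy, which is
       excluded, or ends within it. *)
    + rewrite app_assoc in E2.
      destruct (app_eq_app _ _ _ _ E2) as (f & [[E3 E4]|[E3 E4]]).
      * exfalso. apply Hn. exists e, f. now rewrite E3, app_assoc.
      * exists g, l. split; trivial.
        (* Since [p] and [s] are at least as long as [w], they absorb what the block takes from the
           two bounding copies, and [mid] stays inside the gap. *)
        assert (E5 : w ++ power l g ++ w = (a ++ p) ++ (mid ++ s ++ f)).
        { rewrite app_assoc, E1, <- app_assoc, E3, Eu.
          now rewrite <- !app_assoc. }
        symmetry in E5. apply eq_sym, app_eq_prefix in E5 as (e1 & _ & E6);
          [|rewrite length_app; lia].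
        assert (El := f_equal (@length nat) E6). rewrite !length_app in El.
        rewrite app_assoc in E6. symmetry in E6.
        apply app_eq_prefix in E6 as (e2 & -> & _);
          [|rewrite length_app; lia].
        exists e1, e2. now rewrite <- app_assoc.
    + apply IH. now exists e, r.
Qed.

(** * The inductive construction of the words [w_j] and the lists [h_j] *)

Fixpoint stage (a b : list nat) (j : nat) : list nat * list (list nat) :=
  match j with
  | O => (b, [a])
  | S i => let (w, h) := stage a b i in
           (w ++ flat_map (fun g => power i g ++ w) (w :: h), w :: h)
  end.

Definition top a b j := fst (stage a b j).
Definition prev a b j := snd (stage a b j).

Lemma top_S a b j : top a b (S j) =
  top a b j ++ flat_map (fun g => power j g ++ top a b j) (top a b j :: prev a b j).
Proof. unfold top, prev. simpl. now destruct (stage a b j). Qed.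

Lemma prev_S a b j : prev a b (S j) = top a b j :: prev a b j.
Proof. unfold top, prev. simpl. now destruct (stage a b j). Qed.

Lemma prev_incl a b i j : (i <= j)%nat -> incl (prev a b i) (prev a b j).
Proof.
  intros H. induction H as [|j H IH]; [apply incl_refl|].
  rewrite prev_S. now apply incl_tl.
Qed.

Lemma prev_not_nil a b j : prev a b j <> [].
Proof. destruct j; [discriminate|rewrite prev_S; discriminate]. Qed.

Lemma top_factor a b i j : (i <= j)%nat -> factor (top a b i) (top a b j).
Proof.
  intros H. induction H as [|j H IH]; [apply factor_refl|].
  rewrite top_S. now apply factor_app_l.
Qed.

(** Lists only gain words, so [g] is still present at step [i + l], where its power of exponent
    [i + l] is inserted. *)
Lemma power_factor_top a b i g l : In g (prev a b i) ->
  exists j, (i <= j)%nat /\ factor (power l g) (top a b j).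
Proof.
  intros Hg. exists (S (i + l)). split; [lia|].
  apply factor_trans with (power (i + l) g); [apply power_factor; lia|].
  apply (prev_incl a b i (i + l) ltac:(lia)) in Hg.
  rewrite top_S. apply factor_app_r.
  generalize (in_cons (top a b (i + l)) g _ Hg).
  generalize (top a b (i + l) :: prev a b (i + l)) as hs.
  induction hs as [|g' hs IH]; intros Hin; [contradiction|]. simpl.
  destruct Hin as [->|Hin].
  - apply factor_app_l, factor_app_l, factor_refl.
  - now apply factor_app_r, IH.
Qed.

(** All words of the construction are nonempty concatenations of copies of [a] and [b]. *)
Lemma stage_ind (P : list nat -> Prop) a b :
  P a -> P b -> (forall u v, P u -> P v -> P (u ++ v)) ->
  forall j, P (top a b j) /\ forall g, In g (prev a b j) -> P g.
Proof.
  intros Ha Hb Happ. induction j as [|j [IHt IHp]].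
  - split; [exact Hb|]. now intros g [<-|[]].
  - assert (Hp : forall g, In g (prev a b (S j)) -> P g).
    { rewrite prev_S. intros g [<-|Hg]; auto. }
    split; [|exact Hp]. rewrite top_S, <- prev_S.
    (* Only the leading copy becomes the prefix [A] built so far. Exponents may be 0 and [P []] is
       not assumed, so copies of [g] are appended one by one to a prefix satisfying [P]. *)
    generalize IHt as HA. generalize (top a b j) at 1 2 as A.
    induction (prev a b (S j)) as [|g hs IH]; intros A HA; simpl.
    + now rewrite app_nil_r.
    + rewrite app_assoc. apply IH; [firstorder|].
      rewrite app_assoc. apply Happ; trivial.
      assert (Hg : P g) by (apply Hp; now left). clear - HA Hg Happ.
      induction j as [|l IH]; [now rewrite app_nil_r|].
      rewrite power_S_r, app_assoc. auto.
Qed.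

Lemma stage_not_nil a b j : a <> [] -> b <> [] ->
  top a b j <> [] /\ forall g, In g (prev a b j) -> g <> [].
Proof.
  intros Ha Hb. apply (stage_ind (fun w => w <> [])); trivial.
  intros [|c u] v Hu _; [congruence|discriminate].
Qed.

(** A power inserted later is a single gap if its base is in [prev a b i], and otherwise a run of
    separated words; the induction carries this alternative for all elements of [prev a b j]. *)
Lemma top_separated a b i j : (i <= j)%nat ->
  separated (top a b i) (prev a b i) (top a b j).
Proof.
  intros H.
  set (w := top a b i). set (h := prev a b i).
  assert (Hh : h <> []) by apply prev_not_nil.
  enough (separated w h (top a b j) /\
    forall g, In g (prev a b j) -> In g h \/ separated w h g) by tauto.
  induction H as [|j H [IHt IHp]].
  - split; [constructor|auto].
  - assert (Hp : forall g, In g (prev a b (S j)) -> In g h \/ separated w h g).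
    { rewrite prev_S. intros g [<-|Hg]; auto. }
    split; [|exact Hp]. rewrite top_S, <- prev_S.
    generalize IHt as HA. generalize (top a b j) at 1 2 as A.
    induction (prev a b (S j)) as [|g hs IH]; intros A HA; simpl.
    + now rewrite app_nil_r.
    + rewrite app_assoc. apply IH; [firstorder|].
      destruct (Hp g (or_introl eq_refl)) as [Hg|Hg].
      * now apply separated_glue.
      * apply separated_app; trivial. now apply separated_power_app.
Qed.

(** * The limit shift: invariance and closedness *)

Definition limit_shift (a b : list nat) : cset :=
  fun x => forall t k, exists j, factor (window x t k) (top a b j).

Lemma power_occurs g l u : g <> [] -> factor u (power l g) ->
  exists s, window (per g) s (length u) = u.
Proof.
  intros Hg Hu. destruct (factor_occurs u _ _ _ Hu (window_per g 0 l Hg))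
    as (s & _ & _ & E). eauto.
Qed.

Lemma open_agree X U x : open_in X U -> U x ->
  exists N, forall y, X y -> agree N x y -> U y.
Proof.
  intros [_ HU] Hx. destruct (HU x Hx) as (eps & He & H).
  destruct (half_pow_small eps He) as [N HN]. exists N. intros y Hy Hag.
  apply H; trivial. apply agree_dist_lt in Hag. lra.
Qed.

Lemma occurs_agree N x y s :
  window y s (length (window x (- Z.of_nat N) (2 * N + 1))) =
    window x (- Z.of_nat N) (2 * N + 1) ->
  agree N x (shift_pow (s + Z.of_nat N) y).
Proof.
  rewrite window_length. intros E. apply window_agree.
  rewrite window_shift, <- E. f_equal. lia.
Qed.

Lemma limit_shift_pow a b j x : limit_shift a b x -> limit_shift a b (shift_pow j x).
Proof. intros H t k. rewrite window_shift. apply H. Qed.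

Lemma limit_shift_invariant a b : shift_invariant (limit_shift a b).
Proof.
  intros x. split; intros H; [now apply limit_shift_pow|].
  apply limit_shift_pow with (j := (-1)%Z) in H. unfold shift in H.
  now rewrite shift_pow_add, shift_pow_0 in H.
Qed.

Lemma limit_shift_closed a b n : closed_in n (limit_shift a b).
Proof.
  intros x _ H t k. set (N := (Z.to_nat (Z.abs t) + k)%nat).
  destruct (H ((/ 2) ^ N)) as (y & Hy & Hd); [apply pow_lt; lra|].
  rewrite (agree_window N x y); unfold N; try lia; [apply Hy|].
  now apply dist_lt_agree.
Qed.

(** * The CAM properties of the limit shift *)

Section Limit.

Variables a b : list nat.
Hypothesis Ha : a <> [].
Hypothesis Hb : b <> [].

(** A window of [g^oo] lies in a power of [g], and each power of [g] occurs in some later [w_j]. *)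
Lemma limit_shift_per i g s : In g (prev a b i) ->
  limit_shift a b (shift_pow s (per g)).
Proof.
  intros Hg. apply limit_shift_pow. intros t k.
  destruct (window_per_factor g t k) as [q Hq].
  - now apply (proj2 (stage_not_nil a b i Ha Hb)).
  - destruct (power_factor_top a b i g q Hg) as (j & _ & Hj).
    exists j. now apply factor_trans with (power q g).
Qed.

Lemma limit_shift_per_top j s : limit_shift a b (shift_pow s (per (top a b j))).
Proof. apply (limit_shift_per (S j)). rewrite prev_S. now left. Qed.

Lemma per_top_occurs j u : factor u (top a b j) ->
  exists s, window (per (top a b j)) s (length u) = u.
Proof.
  intros H. apply (power_occurs _ 1).
  - apply (proj1 (stage_not_nil a b j Ha Hb)).
  - unfold power; simpl. now rewrite app_nil_r.
Qed.

Lemma limit_shift_agree_per N x j :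
  factor (window x (- Z.of_nat N) (2 * N + 1)) (top a b j) ->
  exists s, agree N x (shift_pow s (per (top a b j))).
Proof.
  intros H. apply per_top_occurs in H as [s Hs]. exists (s + Z.of_nat N)%Z.
  now apply occurs_agree.
Qed.

(** The [w_j] are nested, so two given windows occur in a common one, and the orbit of the single
    point [(w_j)^oo] meets both open sets. *)
Lemma limit_shift_transitive : topologically_transitive (limit_shift a b).
Proof.
  intros U V HU HV [u Hu] [v Hv].
  destruct (open_agree _ _ _ HU Hu) as [N1 H1].
  destruct (open_agree _ _ _ HV Hv) as [N2 H2].
  destruct (proj1 HU u Hu (- Z.of_nat N1)%Z (2 * N1 + 1)%nat) as [j1 F1].
  destruct (proj1 HV v Hv (- Z.of_nat N2)%Z (2 * N2 + 1)%nat) as [j2 F2].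
  apply factor_trans with (w := top a b (j1 + j2)) in F1; [|apply top_factor; lia].
  apply factor_trans with (w := top a b (j1 + j2)) in F2; [|apply top_factor; lia].
  apply limit_shift_agree_per in F1 as [s1 A1].
  apply limit_shift_agree_per in F2 as [s2 A2].
  exists (s2 - s1)%Z, (shift_pow s1 (per (top a b (j1 + j2)))). split.
  - apply H1; trivial. apply limit_shift_per_top.
  - rewrite shift_pow_add. replace (1 * (s2 - s1) + s1)%Z with s2 by lia.
    apply H2; trivial. apply limit_shift_per_top.
Qed.

Lemma limit_shift_periodic_dense : periodic_dense (limit_shift a b).
Proof.
  intros x Hx eps He. destruct (half_pow_small eps He) as [N HN].
  destruct (Hx (- Z.of_nat N)%Z (2 * N + 1)%nat) as [j F].
  apply limit_shift_agree_per in F as [s A].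
  exists (shift_pow s (per (top a b j))).
  split; [apply limit_shift_per_top|split].
  - apply per_periodic, (proj1 (stage_not_nil a b j Ha Hb)).
  - apply agree_dist_lt in A. lra.
Qed.

(** The central window of [y], widened by [length w] on both sides, occurs in a later separated word
    without meeting a full [w]; hence its middle lies in one gap and agrees with a point of the
    orbit of some [g^oo]. These orbits form a finite, hence closed, set. *)
Lemma limit_shift_avoid j y : limit_shift a b y ->
  (forall s, window y s (length (top a b j)) <> top a b j) ->
  In y (flat_map per_orbit (prev a b j)).
Proof.
  intros Hy Hn. apply finite_agree_In. intros N.
  set (w := top a b j) in *.
  destruct (Hy (- Z.of_nat N - Z.of_nat (length w))%Z
    (length w + ((2 * N + 1) + length w))%nat) as [J F].
  assert (E : forall t k, window y t (length w + (k + length w)) =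
    window y t (length w) ++ window y (t + Z.of_nat (length w)) k ++
    window y (t + Z.of_nat (length w) + Z.of_nat k) (length w))
    by (intros; now rewrite !window_app).
  rewrite E in F.
  (* The index [j + J] is at least [J], where the window occurs, and at least [j], as separation
     requires. *)
  apply factor_trans with (w := top a b (j + J)) in F; [|apply top_factor; lia].
  apply (separated_avoid w (prev a b j)) in F as (g & l & Hg & F);
    rewrite ?window_length; trivial.
  2: apply (proj1 (stage_not_nil a b j Ha Hb)).
  2: apply top_separated; lia.
  2: intros Hw; rewrite <- E in Hw; apply factor_window in Hw as [s Hs];
     now apply (Hn s).
  replace (- Z.of_nat N - Z.of_nat (length w) + Z.of_nat (length w))%Z
    with (- Z.of_nat N)%Z in F by lia.
  assert (Hg0 : g <> []) by now apply (proj2 (stage_not_nil a b j Ha Hb)).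
  apply power_occurs in F as [s Hs]; trivial.
  exists (shift_pow (s + Z.of_nat N) (per g)). split.
  - apply in_flat_map. exists g. split; trivial. now apply per_orbit_In.
  - now apply occurs_agree.
Qed.

(** A closed [Y] missing [x] avoids a central window of [x]. That window is a factor of some [w_j],
    so no point of [Y] contains [w_j]. *)
Lemma limit_shift_proper n Y :
  (forall x, limit_shift a b x -> full_shift n x) ->
  (forall y, Y y -> limit_shift a b y) ->
  (exists x, limit_shift a b x /\ ~ Y x) ->
  closed_in n Y -> shift_invariant Y -> is_finite_set Y.
Proof.
  intros Hfull HYX (x & Hx & HxY) Hcl Hinv.
  assert (HN : exists N, forall y, Y y -> ~ agree N x y).
  { apply NNPP. intros Hn. apply HxY, Hcl; [auto|]. intros eps He.
    destruct (half_pow_small eps He) as [N HN]. apply NNPP. intros Hy.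
    apply Hn. exists N. intros y HyY Hag. apply Hy. exists y. split; trivial.
    apply agree_dist_lt in Hag. lra. }
  destruct HN as [N HN].
  destruct (Hx (- Z.of_nat N)%Z (2 * N + 1)%nat) as [j F].
  exists (flat_map per_orbit (prev a b j)). intros y Hy.
  apply limit_shift_avoid; [auto|]. intros s E.
  destruct (factor_occurs _ _ _ _ F E) as (t & _ & _ & Et).
  apply occurs_agree in Et. apply HN in Et; trivial.
  now apply shift_pow_invariant.
Qed.

(* A point with period [d] agreeing with [a^oo] on a long window is
   [|a|]-periodic, but the points of the orbits of [top j] contain [b]. *)
Lemma limit_shift_faithful i :
  (i + length a < length b)%nat ->
  nth i b 0%nat <> nth (i + length a) b 0%nat ->
  faithful (limit_shift a b).
Proof.
  intros Hi Hne j Hj. apply NNPP. intros Hj0. apply Hne.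
  set (d := Z.abs_nat j).
  (* With exponent [S d], the word contains two copies of [power d a] offset by [length a], each
     covering at least [d] positions. *)
  destruct (power_factor_top a b 0 a (S d) (or_introl eq_refl)) as (m & _ & Fa).
  pose proof (top_factor a b 0 m ltac:(lia)) as Fb.
  change (top a b 0) with b in Fb.
  apply per_top_occurs in Fa as [t Et]. apply per_top_occurs in Fb as [s Es].
  set (x := per (top a b m)) in *.
  assert (Hp : forall k, x (k + j)%Z = x k).
  { intros k. change (shift_pow j x k = x k). rewrite Hj; trivial.
    rewrite <- (shift_pow_0 x). apply limit_shift_per_top. }
  assert (Hd : forall k, x (k + Z.of_nat d)%Z = x k).
  { intros k. rewrite <- (period_mul x j Hp (Z.sgn j) k). f_equal. unfold d.
    rewrite Zabs2Nat.id_abs. lia. }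
  assert (Hloc : forall k, (0 <= k < Z.of_nat d)%Z ->
    x (t + k)%Z = x (t + Z.of_nat (length a) + k)%Z).
  { assert (E1 := Et). rewrite power_S_r in E1. rewrite power_S in Et.
    apply window_eq_app in Et as [_ E2]. apply window_eq_app in E1 as [E1 _].
    rewrite <- E2 in E1 at 2. rewrite window_ext in E1.
    intros k Hk. apply E1. rewrite power_length. apply length_pos in Ha. nia. }
  (* Every residue modulo [d] is represented in the window at [t], so the local period [length a]
     becomes global. *)
  assert (Hglob : forall k, x (k + Z.of_nat (length a))%Z = x k).
  { intros k.
    assert (Hd0 : (0 < Z.of_nat d)%Z) by (unfold d; lia).
    pose proof (Hloc _ (Z.mod_pos_bound (k - t) _ Hd0)) as E.
    rewrite <- (period_mul x _ Hd ((k - t) / Z.of_nat d)) in E.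
    rewrite <- (period_mul x _ Hd ((k - t) / Z.of_nat d)
      (t + Z.of_nat (length a) + _)%Z) in E.
    pose proof (Z.div_mod (k - t) (Z.of_nat d) ltac:(lia)) as Ed.
    symmetry. etransitivity; [|etransitivity; [exact E|]]; f_equal; lia. }
  rewrite window_eq_nth in Es.
  rewrite <- !Es by lia. rewrite <- Hglob. f_equal. lia.
Qed.

End Limit.

(** * The language of [W] and late occurrences *)

Definition lang (W : cset) (u : list nat) : Prop :=
  exists x, W x /\ window x 0 (length u) = u.

Lemma lang_window W x t k : shift_invariant W -> W x -> lang W (window x t k).
Proof.
  intros HW Hx. exists (shift_pow t x). split; [now apply shift_pow_invariant|].
  now rewrite window_shift, window_length.
Qed.

Lemma lang_factor W u w : shift_invariant W -> factor u w -> lang W w -> lang W u.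
Proof.
  intros HW Hf (x & Hx & E).
  destruct (factor_occurs _ _ _ _ Hf E) as (s & _ & _ & <-).
  now apply lang_window.
Qed.

Lemma cylinder_open W t u :
  open_in W (fun x => W x /\ window x t (length u) = u).
Proof.
  split; [tauto|]. intros x [_ E]. set (N := (Z.to_nat (Z.abs t) + length u)%nat).
  exists ((/ 2) ^ N). split; [apply pow_lt; lra|]. intros y Hy Hd. split; trivial.
  rewrite <- (agree_window N x y); unfold N; try lia; trivial.
  now apply dist_lt_agree.
Qed.

Lemma window_sub x y t s k o k' : window x t k = window y s k ->
  (0 <= o)%Z -> (o + Z.of_nat k' <= Z.of_nat k)%Z ->
  window x (t + o) k' = window y (s + o) k'.
Proof.
  rewrite !window_ext. intros H H1 H2 i Hi. rewrite <- !Z.add_assoc. apply H. lia.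
Qed.

(* Transitivity of [sigma^(2p)] from the cylinder of [u] at [0] to that of [u] at
   [-p] yields a return time [p * (2 * j - 1)], of absolute value at least [p]. *)
Lemma return_time W u K : shift_invariant W -> totally_transitive W -> lang W u ->
  exists x k, W x /\ (K <= k)%nat /\
    window x 0 (length u) = u /\ window x (Z.of_nat k) (length u) = u.
Proof.
  intros HW HT (x0 & Hx0 & E0).
  set (p := (Z.of_nat K + 1)%Z).
  destruct (HT (2 * p)%Z ltac:(lia) _ _
    (cylinder_open W 0 u) (cylinder_open W (- p) u)) as (j & x & [Hx E] & [_ E']).
  - eauto.
  - exists (shift_pow p x0). split; [now apply shift_pow_invariant|].
    rewrite window_shift. now replace (- p + p)%Z with 0%Z by lia.
  - rewrite window_shift in E'.
    set (r := (- p + 2 * p * j)%Z) in *.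
    assert (Hr : (Z.of_nat K <= Z.abs r)%Z)
      by (unfold r, p; destruct (Z.le_gt_cases j 0); nia).
    destruct (Z.le_gt_cases 0 r).
    + exists x, (Z.to_nat r). rewrite Z2Nat.id by trivial.
      repeat split; trivial. lia.
    (* A negative return time is turned around by starting at the other occurrence of [u]. *)
    + exists (shift_pow r x), (Z.to_nat (- r)). rewrite !window_shift.
      rewrite Z2Nat.id by lia.
      replace (- r + r)%Z with 0%Z by lia. repeat split; trivial.
      * now apply shift_pow_invariant.
      * lia.
Qed.

(** Transitivity gives [u] and [v] in one point at an offset [j] of unknown sign. A window
    containing both returns after [k >= K + |j|] steps; [u] from its first copy and [v] from its
    second are at distance [k + j >= K]. *)
Lemma transitive_late W u v K :
  shift_invariant W -> totally_transitive W -> lang W u -> lang W v ->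
  exists x k, W x /\ (K <= k)%nat /\
    window x 0 (length u) = u /\ window x (Z.of_nat k) (length v) = v.
Proof.
  intros HW HT (x1 & Hx1 & E1) (x2 & Hx2 & E2).
  destruct (HT 1%Z ltac:(lia) _ _ (cylinder_open W 0 u) (cylinder_open W 0 v))
    as (j & x & [Hx Eu] & [_ Ev]); eauto.
  rewrite window_shift in Ev.
  set (d := Z.abs_nat j).
  set (m := (2 * d + length u + length v)%nat).
  destruct (return_time W (window x (- Z.of_nat d) m) (K + d) HW HT)
    as (y & k & Hy & Hk & F1 & F2); [now apply lang_window|].
  rewrite window_length in F1, F2.
  exists (shift_pow (Z.of_nat d) y), (Z.to_nat (Z.of_nat k + j)).
  rewrite !window_shift. split; [now apply shift_pow_invariant|].
  split; [unfold d in *; lia|]. split.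
  - rewrite <- Eu at 2.
    replace 0%Z with (- Z.of_nat d + Z.of_nat d)%Z at 2 by lia.
    apply window_sub with m; unfold m; trivial; lia.
  - rewrite <- Ev at 2.
    replace (Z.of_nat (Z.to_nat (Z.of_nat k + j)) + Z.of_nat d)%Z
      with (Z.of_nat k + (Z.of_nat d + j))%Z by (unfold d in *; lia).
    replace (0 + 1 * j)%Z with (- Z.of_nat d + (Z.of_nat d + j))%Z by lia.
    apply window_sub with m; unfold m, d; trivial; lia.
Qed.

(** * Consequences of the finiteness of the alphabet *)

Fixpoint words (n L : nat) : list (list nat) :=
  match L with
  | O => [[]]
  | S L' => flat_map (fun c => map (cons c) (words n L')) (seq 1 n)
  end.

Lemma window_words n x t k : full_shift n x -> In (window x t k) (words n k).
Proof.
  intros Hx. revert t. induction k as [|k IH]; intros t; simpl; [now left|].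
  apply in_flat_map. exists (x t). split.
  - apply in_seq. specialize (Hx t). lia.
  - now apply in_map.
Qed.

Lemma lang_words n W u : (forall x, W x -> full_shift n x) -> lang W u ->
  In u (words n (length u)).
Proof. intros HW (x & Hx & E). rewrite <- E at 1. now apply window_words, HW. Qed.

Lemma nonempty_of_infinite W : ~ is_finite_set W -> exists x, W x.
Proof.
  intros H. apply NNPP. intros Hn. apply H. exists []. intros x Hx. apply Hn. eauto.
Qed.

(** Otherwise each point of [W] is determined by a word of length [d], and there are finitely many
    of these. *)
Lemma not_periodic_of_infinite n W d : (0 < d)%nat ->
  (forall x, W x -> full_shift n x) -> ~ is_finite_set W ->
  exists x k, W x /\ x k <> x (k + Z.of_nat d)%Z.
Proof.
  intros Hd HW Hinf. apply NNPP. intros Hn. apply Hinf.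
  exists (map per (words n d)). intros x Hx. apply in_map_iff.
  exists (window x 0 d). split; [|now apply window_words, HW].
  symmetry. apply eq_per_window; trivial. intros k. apply NNPP. intros Hk.
  apply Hn. exists x, k. auto.
Qed.

(** * Words containing all short words, and return words *)

(** Words of [us] are absorbed one at a time: some word of [W] contains both the next one and the
    word obtained so far. *)
Lemma common_word W us :
  shift_invariant W -> totally_transitive W -> (exists x, W x) ->
  exists v, lang W v /\ forall u, In u us -> lang W u -> factor u v.
Proof.
  intros HW HT [x0 Hx0]. induction us as [|u us (v & Hv & Hus)].
  - exists []. split; [now exists x0|]. intros u [].
  - destruct (classic (lang W u)) as [Hu|Hu].
    + destruct (transitive_late W u v 0 HW HT Hu Hv) as (x & k & Hx & _ & E1 & E2).
      exists (window x 0 (length u + (k + length v))).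
      split; [now apply lang_window|].
      intros u' [<-|Hu'] Hl.
      * rewrite <- E1 at 1. apply window_factor; lia.
      * apply factor_trans with v; [auto|]. rewrite <- E2 at 1.
        apply window_factor; lia.
    + exists v. split; trivial. intros u' [<-|Hu'] Hl; [contradiction|auto].
Qed.

(* For [L <= length v] these words are closed under concatenation, since the factors
   of length [L] of [a ++ b ++ v] lie in [a ++ v] or in [b ++ v]. *)
Definition return_word (W : cset) (L : nat) (v a : list nat) : Prop :=
  (forall u, length u = L -> factor u (a ++ v) -> lang W u) /\
  exists r, a ++ v = v ++ r.

Lemma return_word_app W L v a b : (L <= length v)%nat ->
  return_word W L v a -> return_word W L v b -> return_word W L v (a ++ b).
Proof.
  intros HL [Ha [r Er]] [Hb [s Es]]. split.
  - intros u Hu (p & q & E). rewrite <- app_assoc in E.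
    destruct (app_eq_app _ _ _ _ E) as (e & [[E1 E2]|[E1 E2]]).
    (* The word [b ++ v] starts with [v], and a factor of length [L <= length v] that starts in [a]
       ends no later than this [v]. *)
    + rewrite Es in E2.
      assert (E3 : u ++ q = (e ++ v) ++ s) by now rewrite <- app_assoc.
      apply app_eq_prefix in E3 as (f & E3 & _); [|rewrite length_app; lia].
      apply Ha; trivial. exists p, f. now rewrite E1, <- app_assoc, E3.
    + apply Hb; trivial. now exists e, q.
  - exists (r ++ s). now rewrite <- app_assoc, Es, app_assoc, Er, <- app_assoc.
Qed.

Lemma return_word_window W L v x k : shift_invariant W -> W x ->
  window x 0 (length v) = v -> window x (Z.of_nat k) (length v) = v ->
  return_word W L v (window x 0 k).
Proof.
  intros HW Hx E1 E2. unfold return_word.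
  assert (E : window x 0 k ++ v = window x 0 (k + length v))
    by now rewrite window_app, Z.add_0_l, E2.
  rewrite E. split.
  - intros u _ Hu. apply (lang_factor W _ _ HW Hu). now apply lang_window.
  - rewrite Nat.add_comm, window_app, E1. eauto.
Qed.

(** The word [a] is any nonempty return word; [b] is a return word long enough to contain [v], hence
    all words of length [L], and a violation of the period [length a]. *)
Lemma exists_return_words n W L :
  subshift n W -> ~ is_finite_set W -> totally_transitive W ->
  exists v a b i,
    (L <= length v)%nat /\
    return_word W L v a /\ return_word W L v b /\
    (forall u, lang W u -> length u = L -> factor u b) /\ a <> [] /\
    (i + length a < length b)%nat /\ nth i b 0%nat <> nth (i + length a) b 0%nat.
Proof.
  intros (Hfull & _ & HW) Hinf HT.
  destruct (nonempty_of_infinite W Hinf) as [x0 Hx0].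
  destruct (common_word W (words n L) HW HT (ex_intro _ x0 Hx0)) as (v & Hv & HvL).
  assert (HvL' : forall u, lang W u -> length u = L -> factor u v).
  { intros u Hu <-. apply HvL; trivial. now apply lang_words with W. }
  assert (HLv : (L <= length v)%nat).
  { rewrite <- (window_length x0 0 L). apply factor_length, HvL'.
    - now apply lang_window.
    - apply window_length. }
  destruct (return_time W v 1 HW HT Hv) as (xa & d & Hxa & Hd & A1 & A2).
  destruct (not_periodic_of_infinite n W d ltac:(lia) Hfull Hinf)
    as (z & t & Hz & Hne).
  (* Length [S d] makes [c] include both [t] and [t + d], where [z] takes different values. *)
  set (c := window z t (S d)).
  assert (Hc : length c = S d) by apply window_length.
  destruct (transitive_late W v c (length v) HW HT Hv)
    as (y & k & Hy & Hk & Y1 & Y2); [now apply lang_window|].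
  (* [T] starts with [v] and ends with [c]; the next step finds [v] again after a whole copy of [T],
     so the return word contains [T]. *)
  set (T := window y 0 (k + length c)).
  assert (HT' : length T = (k + length c)%nat) by apply window_length.
  destruct (transitive_late W T v (length T) HW HT)
    as (xb & e & Hxb & He & B1 & B2); [now apply lang_window|trivial|].
  assert (Fv : factor v T) by (rewrite <- Y1 at 1; apply window_factor; lia).
  assert (Fc : factor c T) by (rewrite <- Y2 at 1; apply window_factor; lia).
  assert (FT : factor T (window xb 0 e)) by (rewrite <- B1 at 1; apply window_factor; lia).
  assert (B0 : window xb 0 (length v) = v).
  { rewrite <- Y1 at 2. unfold T in B1. rewrite window_length in B1.
    apply (window_sub xb y 0 0 (k + length c) 0); trivial; lia. }
  destruct (factor_trans _ _ _ Fc FT) as (l & r & Eb).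
  assert (Hnth : forall i, (i <= d)%nat ->
    nth (length l + i) (window xb 0 e) 0%nat = z (t + Z.of_nat i)%Z).
  { intros i Hi. rewrite Eb, app_nth2_plus, app_nth1 by lia. symmetry.
    apply window_eq_nth; [|lia]. now rewrite Hc. }
  exists v, (window xa 0 d), (window xb 0 e), (length l).
  split; [trivial|]. split; [now apply return_word_window|].
  split; [now apply return_word_window|]. split; [|split; [|split]].
  - intros u Hu HL. apply factor_trans with v; [auto|].
    now apply factor_trans with T.
  - destruct d; [lia|discriminate].
  - rewrite Eb, window_length, !length_app. lia.
  - rewrite window_length, Hnth by lia.
    rewrite <- (Nat.add_0_r (length l)), Hnth by lia. now rewrite Z.add_0_r.
Qed.

(** * CAM subshifts with the words of length [L] of [W], and convergence *)

(** In the limit shift of [a] and [b], words of length [L] are factors of return words and so belong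
    to [W]; conversely [w_0 = b] contains every word of [W] of that length. *)
Lemma exists_CAM_same_words n W L : (1 <= L)%nat ->
  subshift n W -> ~ is_finite_set W -> totally_transitive W ->
  exists X, subshift n X /\ CAM n X /\
    (forall x t, X x -> lang W (window x t L)) /\
    (forall u t, lang W u -> length u = L -> exists x, X x /\ window x t L = u).
Proof.
  intros HL HWs Hinf HT.
  destruct (exists_return_words n W L HWs Hinf HT)
    as (v & a & b & i & Hv & Ra & Rb & Hbu & Ha & Hi & Hne).
  assert (Hb : b <> []) by (intros ->; simpl in Hi; lia).
  assert (Hlang : forall x t, limit_shift a b x -> lang W (window x t L)).
  { intros x t Hx. destruct (Hx t L) as [j Hj].
    destruct (stage_ind (return_word W L v) a b Ra Rb) with (j := j)
      as [[H _] _].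
    - intros p q. now apply return_word_app.
    - apply H; [apply window_length|]. now apply factor_app_l. }
  assert (Hfull : forall x, limit_shift a b x -> full_shift n x).
  { intros x Hx k. destruct (Hlang x k Hx) as (y & Hy & E).
    rewrite window_length, window_ext in E. specialize (E 0%Z ltac:(lia)).
    rewrite !Z.add_0_r in E. rewrite <- E. now apply (proj1 HWs). }
  exists (limit_shift a b). split; [|split; [|split]]; trivial.
  - split; [trivial|split]; [apply limit_shift_closed|apply limit_shift_invariant].
  - split; [split|split].
    + now apply limit_shift_transitive.
    + now apply (limit_shift_faithful a b Ha Hb i).
    + now apply limit_shift_periodic_dense.
    + intros Y. now apply limit_shift_proper.
  - intros u t Hu HuL. specialize (Hbu u Hu HuL).
    apply (per_top_occurs a b Ha Hb 0) in Hbu as [s Hs].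
    exists (shift_pow (s - t) (per (top a b 0))).
    split; [now apply limit_shift_per_top|].
    rewrite window_shift, <- Hs, HuL. f_equal. lia.
Qed.

Theorem theorem2p10 (n : nat) (W : cset) :
  (2 <= n)%nat ->
  subshift n W -> ~ is_finite_set W -> totally_transitive W ->
  exists Xs : nat -> cset,
    (forall m, subshift n (Xs m) /\ CAM n (Xs m)) /\
    hausdorff_converges Xs W.
Proof.
  intros _ HWs Hinf HT.
  (* Words of length [2 * m + 1] are the windows on [[-m, m]]; sharing them puts each point of
     either subshift within [(/ 2) ^ m] of the other. Choice selects one subshift for each [m]. *)
  pose proof (fun m => constructive_indefinite_description _
    (exists_CAM_same_words n W (2 * m + 1) ltac:(lia) HWs Hinf HT)) as S.
  set (Xs m := proj1_sig (S m)). pose proof (fun m => proj2_sig (S m)) as HXs.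
  exists Xs. split.
  - intros m. destruct (HXs m) as (H1 & H2 & _). auto.
  - assert (HW : shift_invariant W) by apply HWs.
    intros eps He. destruct (half_pow_small eps He) as [M HM]. exists M.
    intros m Hm. destruct (HXs m) as (_ & _ & HX1 & HX2).
    assert (Hd : forall x y, agree m x y -> dist x y < eps).
    { intros x y Hag. apply Rlt_trans with (2 := HM), agree_dist_lt.
      intros k Hk. apply Hag. lia. }
    split.
    + intros x Hx. destruct (HX1 x (- Z.of_nat m)%Z Hx) as (y & Hy & E).
      exists (shift_pow (Z.of_nat m) y). split; [now apply shift_pow_invariant|].
      apply Hd, window_agree. rewrite window_shift.
      replace (- Z.of_nat m + Z.of_nat m)%Z with 0%Z by lia.
      now rewrite window_length in E.
    + intros y Hy.
      destruct (HX2 (window y (- Z.of_nat m) (2 * m + 1)) (- Z.of_nat m)%Z)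
        as (x & Hx & E).
      * now apply lang_window.
      * apply window_length.
      * exists x. split; trivial. now apply Hd, window_agree.
Qed.
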